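(* Let $N\ge 1$, let $a_1<\dots<a_N$ be real numbers, let $\lambda_1,\dots,\lambda_N>0$, and let $$f(x)=x-\sum_{j=1}^N\frac{\lambda_j}{x-a_j}.$$ Let $k\in\{0,\dots,N\}$, let $b_k$ be the unique zero of $f$ in $]a_k,a_{k+1}[$ (with $a_0=-\infty$, $a_{N+1}=+\infty$), and let $x_k(w)$ be the local analytic inverse of $w=f(x)$ near $x=b_k$. For $i\ge 1$ set $$g_i(z)=\frac{\partial^{i-1}}{\partial z^{i-1}}\left\{\left[\frac{z-b_k}{f(z)}\right]^i\right\}.$$ Then, for $w$ in a neighbourhood of $0$, $$x_k(w)=b_k+\sum_{i=1}^{+\infty} g_i(b_k)\frac{w^i}{i!}.$$
   Context: Under the stated hypotheses $f$ has exactly one zero $b_k$ in each interval $]a_k,a_{k+1}[$, $k=0,\dots,N$, and it is simple; thus $f(x)=\prod_{k=0}^N(x-b_k)/\prod_{j=1}^N(x-a_j)$. The function $z\mapsto (z-b_k)/f(z)$ is extended analytically across its removable singularity $z=b_k$, so $g_i(b_k)$ makes sense. The local inverse $x_k(w)$ is the unique analytic function (equivalently, convergent power series) defined near $w=0$ with $x_k(0)=b_k$ and $f(x_k(w))=w$. *)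

(* Defs.v *)
From mathcomp Require Import all_boot all_order all_algebra.
From mathcomp Require Import complex.
From mathcomp Require Import all_classical all_reals all_analysis.

Set Implicit Arguments.
Unset Strict Implicit.
Unset Printing Implicit Defensive.

Import Order.TTheory GRing.Theory Num.Theory.
Import numFieldNormedType.Exports.

Local Open Scope classical_set_scope.
Local Open Scope ring_scope.

(* The poles are indexed from 1 to N; the values of a and lambda at other
   indices are never used. The endpoints are a_0 = -oo and a_(N+1) = +oo. *)
Definition endpoint (R : realType) (N : nat) (a : nat -> R) (k : nat) : \bar R :=
  if k == 0%N then -oo%E else if (k <= N)%N then (a k)%:E else +oo%E.

(* K is R or R[i] below. At a pole, the value is meaningless (0^-1 = 0). *)
Definition rational_map (K : numFieldType) (N : nat) (a lambda : nat -> K)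
    (z : K) : K :=
  z - \sum_(1 <= j < N.+1) lambda j / (z - a j).

Definition analytic_at (K : numFieldType) (F : K -> K) (z0 : K) : Prop :=
  exists c : nat -> K, \forall z \near z0,
    [series c n * (z - z0) ^+ n]_n @ \oo --> F z.

Definition local_analytic_inverse (K : numFieldType) (f : K -> K) (b : K)
    (x : K -> K) : Prop :=
  [/\ analytic_at x 0, x 0 = b & \forall w \near (0 : K), f (x w) = w].

(* Across a removable singularity c, the analytic extension is the continuous
   one, so its value at c is the limit of h over the punctured neighbourhoods. *)
Definition extend_at (K : numFieldType) (c : K) (h : K -> K) (z : K) : K :=
  if z == c then lim (h y @[y --> c^']) else h z.

(* Used for i >= 1 only. *)
Definition lagrange_coef (K : numFieldType) (f : K -> K) (b : K) (i : nat)
    : K -> K :=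
  derive1n i.-1 (fun z : K => extend_at b (fun y => (y - b) / f y) z ^+ i).

(* Main.v *)
(** Near [b] one has [f z = (z - b) M(z - b) / D(z - b)] for polynomials [M], [D]
    that do not vanish at [0], so [phi = D / M] extends [(z - b) / f z]. Any analytic
    inverse [x] of [f] then satisfies [x - b = w phi(x - b)] modulo every power of
    [w], once [x] is replaced by the truncations of its power series. The formal
    Lagrange inversion [n [w^n] x = [t^(n-1)] phi^n], obtained from the invariance
    of residues under [t = x(w) - b], identifies the coefficients of [x]. Everything
    takes place over an arbitrary [numFieldType], hence covers both [R] and [R[i]]. *)

Require Import Defs.
From mathcomp Require Import all_boot all_order all_algebra.
From mathcomp Require Import complex.
From mathcomp Require Import all_classical all_reals all_analysis.
From mathcomp Require Import ring.

Set Implicit Arguments.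
Unset Strict Implicit.
Unset Printing Implicit Defensive.

Import Order.TTheory GRing.Theory Num.Theory.
Import numFieldNormedType.Exports.

Local Open Scope classical_set_scope.
Local Open Scope ring_scope.

(** * Congruences of polynomials modulo a power of ['X] *)

Local Notation eqmodp d p q := (d %| p - q).

Section PolyCongruence.
Variable K : fieldType.
Implicit Types (d p q u : {poly K}) (m n i : nat).

Lemma eqmodp_refl d p : eqmodp d p p.
Proof. by rewrite subrr dvdp0. Qed.

Lemma eqmodpM d p p' q q' :
  eqmodp d p p' -> eqmodp d q q' -> eqmodp d (p * q) (p' * q').
Proof.
move=> pp' qq'.
have -> : p * q - p' * q' = (p - p') * q + p' * (q - q') by ring.
by apply: dvdp_add; [exact: dvdp_mulr | exact: dvdp_mull].
Qed.

Lemma eqmodpXn d p q n : eqmodp d p q -> eqmodp d (p ^+ n) (q ^+ n).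
Proof. by move=> pq; rewrite subrXX dvdp_mulr. Qed.

Lemma eqmodp_coef m p q i : eqmodp 'X^m p q -> (i < m)%N -> p`_i = q`_i.
Proof.
case/dvdpP=> r /(congr1 (fun s : {poly K} => s`_i)); rewrite coefB coefMXn => + im.
by rewrite im => /eqP; rewrite subr_eq0 => /eqP.
Qed.

Lemma dvdp_deriv m p : 'X^(m.+1) %| p -> 'X^m %| p^`().
Proof.
case/dvdpP=> r ->; rewrite derivM derivXn; apply: dvdp_add.
  by rewrite exprS mulrA dvdp_mulIr.
by rewrite -mulr_natr mulrCA dvdp_mulIl.
Qed.

(** A nonzero constant term makes [u] coprime to ['X^m], so Bezout provides the inverse. *)
Lemma exists_inv_modXn m u : u.[0] != 0 -> exists v, eqmodp 'X^m (u * v) 1.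
Proof.
move=> u0; have : coprimep u 'X^m by rewrite coprimep_expr// coprimepX.
move/Bezout_eq1_coprimepP => [[v s] /= vs]; exists v.
by rewrite -vs opprD addrA mulrC subrr sub0r dvdpNr dvdp_mull.
Qed.

End PolyCongruence.

(** * Formal Lagrange inversion by residues *)

Section FormalLagrange.
Variable K : numFieldType.
Implicit Types (u v y Phi : {poly K}) (m n k : nat).

(* The residue of y^(-k-1) dy for y = X u, with v standing for 1/u: it
   vanishes for k > 0 because y^(-k-1) dy = - d(y^-k) / k. *)
Lemma coef_residue m k u v : eqmodp 'X^m (u * v) 1 -> (k < m)%N ->
  ((u + 'X * u^`()) * v ^+ k.+1)`_k = (k == 0%N)%:R.
Proof.
move=> uv km; case: k km => [|k] km.
  rewrite expr1 mulrDl coefD -mulrA coefXM eqxx addr0.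
  by rewrite (eqmodp_coef uv km) coef1.
(* From [u v = 1] follows [u' v^2 = - v']. The error involves [e'], controlled modulo one power of
   ['X] less, but it carries a factor ['X]. *)
have h : eqmodp 'X^m ((u + 'X * u^`()) * v ^+ k.+2)
                     (v ^+ k.+1 - 'X * (v ^+ k * v^`())).
  set e := u * v - 1 in uv.
  have -> : (u + 'X * u^`()) * v ^+ k.+2 - (v ^+ k.+1 - 'X * (v ^+ k * v^`())) =
            (v ^+ k.+1 - 'X * v ^+ k * v^`()) * e + v ^+ k.+1 * ('X * e^`()).
    by rewrite /e derivB derivM derivC !exprS; ring.
  apply: dvdp_add; apply: dvdp_mull => //.
  case: m km uv => // m _ uv; rewrite exprS dvdp_mul2l ?polyX_eq0//.
  exact: dvdp_deriv.
rewrite (eqmodp_coef h km) coefB coefXM [RHS]/=.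
(* As [(v^(k+1))' = (k+1) v^k v'] and [k+1] cancels in characteristic 0, the two coefficients
   agree. *)
have : (v ^+ k.+1)`_k.+1 *+ k.+1 = (v ^+ k * v^`())`_k *+ k.+1.
  by rewrite -coef_deriv deriv_exp /= coefMn mulrC.
by move=> /eqP; rewrite eqrMn2r//= => /eqP->; rewrite subrr.
Qed.

(** With [v] inverse to [u = Phi \Po y], one has [y' = y' v^n u^n] modulo ['X^n]. Expanding
    [u^n = Phi^n \Po y] in powers of [y], the residues of [y^(j-n) dy] keep only the term
    [j = n - 1]. *)
Lemma formal_lagrange n y Phi : (0 < n)%N -> Phi.[0] != 0 ->
  eqmodp 'X^(n.+1) y ('X * (Phi \Po y)) -> y`_n *+ n = (Phi ^+ n)`_n.-1.
Proof.
case: n => // n _ Phi0 yE; set u := Phi \Po y in yE.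
have y0 : y.[0] = 0.
  by rewrite horner_coef0 (eqmodp_coef yE)// coefXM.
have u0 : u.[0] != 0 by rewrite horner_comp y0.
have [v uv] := exists_inv_modXn n.+1 u0.
have y'E : eqmodp 'X^(n.+1) y^`() (u + 'X * u^`()).
  by move/dvdp_deriv: yE; rewrite derivB derivM derivX mul1r.
have {}yE : eqmodp 'X^(n.+1) y ('X * u).
  by apply: dvdp_trans yE; rewrite dvdp_exp2l.
(* The exponent is now [n.+1]. Since [v / X] inverts [y], this is the residue of [y^(j-n-1) dy]. For
   [j > n] the factor ['X^j] kills the coefficient; otherwise [(u v)^j] cancels and [coef_residue]
   applies. *)
have term j : (y^`() * v ^+ n.+1 * y ^+ j)`_n = (j == n)%:R.
  have h := eqmodpM (eqmodpM y'E (eqmodp_refl _ (v ^+ n.+1))) (eqmodpXn j yE).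
  rewrite (eqmodp_coef h (leqnn _)) exprMn mulrCA coefXnM.
  have [nj|jn] := ltnP n j; first by rewrite gtn_eqF.
  have [k nE] : exists k, n = (k + j)%N by exists (n - j)%N; rewrite subnK.
  have {}h : eqmodp 'X^(n.+1) ((u + 'X * u^`()) * v ^+ n.+1 * u ^+ j)
                   ((u + 'X * u^`()) * v ^+ k.+1).
    have -> : (u + 'X * u^`()) * v ^+ n.+1 * u ^+ j =
              (u + 'X * u^`()) * v ^+ k.+1 * (u * v) ^+ j.
      by rewrite nE exprMn -addSn exprD; ring.
    rewrite -[X in eqmodp _ _ X]mulr1; apply: eqmodpM; first exact: eqmodp_refl.
    by rewrite -(expr1n _ j); apply: eqmodpXn.
  rewrite (eqmodp_coef h) ?ltnS ?leq_subr// nE addnK.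
  rewrite (coef_residue uv) ?nE ?ltnS ?leq_addr//.
  by rewrite eq_sym -{1}[j]add0n eqn_add2r eq_sym.
rewrite -coef_deriv /=.
have h : eqmodp 'X^(n.+1) (y^`() * v ^+ n.+1 * u ^+ n.+1) y^`().
  rewrite -mulrA -exprMn -[X in eqmodp _ _ X]mulr1.
  apply: eqmodpM; first exact: eqmodp_refl.
  by rewrite -(expr1n _ n.+1) mulrC; apply: eqmodpXn.
rewrite -(eqmodp_coef h (leqnn _)) -rmorphXn /= comp_polyE mulr_sumr coef_sum.
under eq_bigr do rewrite -scalerAr coefZ term.
(* If [Phi ^+ n.+1] has no coefficient of index [n], both sides are 0. *)
have [nS|Sn] := ltnP n (size (Phi ^+ n.+1)).
  rewrite (bigD1 (Ordinal nS)) //= eqxx mulr1 big1 ?addr0// => i.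
  by rewrite -val_eqE /= => /negPf->; rewrite mulr0.
rewrite nth_default// big1// => i _; rewrite ltn_eqF ?mulr0//.
exact: leq_trans (ltn_ord i) Sn.
Qed.

End FormalLagrange.

(** * Iterated derivatives of rational germs *)

Section RationalGerm.
Variable K : numFieldType.
Implicit Types (p q P : {poly K}) (b z : K) (F : K -> K).

Lemma is_derive_horner_shift p b z :
  is_derive z 1 (fun w : K => p.[w - b]) p^`().[z - b].
Proof.
elim/poly_ind: p => [|p c IHp].
  rewrite deriv0 horner0 [X in is_derive _ _ X _](_ : _ = cst 0).
    exact: is_derive_cst.
  by apply/funext => w; rewrite horner0.
rewrite [X in is_derive _ _ X _](_ : _ =
    (fun w => p.[w - b]) * (id - cst b) + cst c); last first.
  by apply/funext => w; rewrite !hornerE.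
apply: is_derive_eq; rewrite derivD derivM derivX derivC !hornerE.
by rewrite /GRing.scale /= subr0 mulr1 addrC [(_ \+ _) _ * _]mulrC.
Qed.

Lemma continuous_horner_shift p b z : {for z, continuous (fun w : K => p.[w - b])}.
Proof.
apply/differentiable_continuous/derivable1_diffP.
by have [] := is_derive_horner_shift p b z.
Qed.

Lemma near_horner_shift_neq0 p b : p.[0] != 0 -> \forall z \near b, p.[z - b] != 0.
Proof.
move=> p0; have := @continuous_horner_shift p b b.
rewrite /prop_for /continuous_at subrr => /cvgr_neq0; exact.
Qed.

Lemma derive1_ratfun p q b z : q.[z - b] != 0 ->
  derive1 (fun w : K => p.[w - b] / q.[w - b]) z =
  (p^`() * q - p * q^`()).[z - b] / (q ^+ 2).[z - b].
Proof.
move=> q0; rewrite derive1E.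
have [dp pE] := is_derive_horner_shift p b z.
have [dq qE] := is_derive_horner_shift q b z.
pose g (w : K) := q.[w - b].
have dV : derivable (fun w => (g w)^-1) z 1 by exact: (@derivableV _ _ g).
apply: etrans (deriveM dp dV) _.
rewrite (@deriveV _ _ g)// pE qE /g.
rewrite !hornerE /GRing.scale /=; field.
by rewrite q0.
Qed.

(** [P] is a Taylor polynomial of [p / q]. Differentiation sends [p / q] to [(p' q - p q') / q^2]
    and [P] to [P'], and costs one power of ['X], whence [i < m]. *)
Lemma derive1n_ratfun m i F p q P b : (i < m)%N -> q.[0] != 0 ->
  eqmodp 'X^m (P * q) p -> (\forall z \near b, F z = p.[z - b] / q.[z - b]) ->
  derive1n i F b = P`_i *+ i`!.
Proof.
elim: i m F p q P => [|i IHi] [|m]// F p q P im q0 Pq FE.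
  rewrite /= (nbhs_singleton FE) subrr !horner_coef0 -(eqmodp_coef Pq im).
  by rewrite coef0M mulfK// -horner_coef0.
rewrite derive1Sn (IHi m _ (p^`() * q - p * q^`()) (q ^+ 2) P^`()) //.
- by rewrite coef_deriv -mulrnA -factS.
- by rewrite horner_exp expf_neq0.
- have -> : P^`() * q ^+ 2 - (p^`() * q - p * q^`()) =
      (P * q - p)^`() * q - (P * q - p) * q^`().
    by rewrite derivB derivM; ring.
  apply: dvdp_sub; apply: dvdp_mulr; first exact: dvdp_deriv.
  by apply: dvdp_trans Pq; rewrite dvdp_exp2l.
(* To compare derivatives at [z], the two functions must agree near every [z] close to [b]. *)
have FE' := near_join FE.
near=> z.
rewrite -derive1_ratfun; last first.
  by near: z; exact: near_horner_shift_neq0.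
rewrite !derive1E; apply: near_eq_derive.
by near: z; exact: FE'.
Unshelve. all: by end_near. Qed.

End RationalGerm.

(** * Polynomial approximation at 0 and power series *)

Section Approximation.
Variable K : numFieldType.
Implicit Types (p q r : {poly K}) (m : nat) (g h : K -> K).

(** This is [h = p + O(w^m)] at 0. The neighbourhood contains [w = 0], so [h 0 = p.[0]] as soon as
    [m > 0]. *)
Definition poly_approx m h p := exists2 C : K, 0 <= C &
  \forall w \near (0 : K), `|h w - p.[w]| <= C * `|w| ^+ m.

Lemma poly_approx_horner_id m p : poly_approx m (horner p) p.
Proof.
by exists 0 => //; near=> w; rewrite subrr normr0 mul0r.
Unshelve. all: by end_near. Qed.

Lemma near0_norm_le1 : \forall w \near (0 : K), `|w| <= 1.
Proof. exact: (nbhs0_le ltr01). Qed.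

Lemma near0_horner_bounded p : exists2 C : K, 0 <= C &
  \forall w \near (0 : K), `|p.[w]| <= C.
Proof.
exists (`|p.[0]| + 1); first by rewrite addr_ge0.
have := @continuous_horner_shift K p 0 0.
rewrite /prop_for /continuous_at subrr => /cvgr_norm_le p0.
have {}p0 := p0 _ (ltr_pwDr ltr01 (lexx _)).
by near=> w; rewrite -(subr0 w); near: w.
Unshelve. all: by end_near. Qed.

Lemma poly_approxD m g h p q : poly_approx m g p -> poly_approx m h q ->
  poly_approx m (fun w => g w + h w) (p + q).
Proof.
move=> [C C0 gp] [D D0 hq]; exists (C + D); first exact: addr_ge0.
near=> w; rewrite hornerD opprD addrACA (le_trans (ler_normD _ _))// mulrDl.
by rewrite lerD//; near: w.
Unshelve. all: by end_near. Qed.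

Lemma poly_approxM m g h p q : poly_approx m g p -> poly_approx m h q ->
  poly_approx m (fun w => g w * h w) (p * q).
Proof.
move=> [C C0 gp] [D D0 hq].
have [A A0 pA] := near0_horner_bounded p.
have [B B0 qB] := near0_horner_bounded q.
(* One constant for each term of the expansion below; in the product of the two errors, one factor
   [|w|^m] is bounded by 1. *)
exists (C * D + C * B + A * D); first by rewrite !addr_ge0// mulr_ge0.
near=> w.
have gpw : `|g w - p.[w]| <= C * `|w| ^+ m by near: w.
have hqw : `|h w - q.[w]| <= D * `|w| ^+ m by near: w.
have w1 : `|w| ^+ m <= 1 by rewrite exprn_ile1//; near: w; exact: near0_norm_le1.
have hqD : `|h w - q.[w]| <= D by rewrite (le_trans hqw)// ler_piMr.
have -> : g w * h w - (p * q).[w] = (g w - p.[w]) * (h w - q.[w]) +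
    (g w - p.[w]) * q.[w] + p.[w] * (h w - q.[w]) by rewrite hornerM; ring.
rewrite (le_trans (ler_normD _ _))// [leRHS]mulrDl lerD//.
  rewrite (le_trans (ler_normD _ _))// [leRHS]mulrDl !normrM lerD//.
    by rewrite mulrAC ler_pM.
  by rewrite mulrAC ler_pM//; near: w.
by rewrite normrM -mulrA ler_pM//; near: w.
Unshelve. all: by end_near. Qed.

Lemma poly_approx_comp m h p r : poly_approx m h p ->
  poly_approx m (fun w => r.[h w]) (r \Po p).
Proof.
move=> hp; elim/poly_ind: r => [|r c IHr].
  rewrite comp_poly0 (_ : (fun w => 0.[h w]) = horner 0).
    exact: poly_approx_horner_id.
  by apply/funext => w; rewrite !horner0.
rewrite comp_polyD comp_polyM comp_polyX comp_polyC.
rewrite (_ : (fun w => _) = (fun w => r.[h w] * h w + c%:P.[w])).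
  by apply: poly_approxD; [exact: poly_approxM | exact: poly_approx_horner_id].
by apply/funext => w; rewrite !hornerE.
Qed.

Lemma horner0_small p (C : K) : 0 <= C ->
  (\forall w \near (0 : K)^', `|p.[w]| <= C * `|w|) -> p.[0] = 0.
Proof.
move=> C0 pC; apply/eqP/negPn/negP => p0.
have e0 : 0 < `|p.[0]| / 2 by rewrite divr_gt0 ?normr_gt0.
(* [C] may be 0, so [C + 1] is used as divisor. *)
have C1 : 0 < C + 1 by rewrite ltr_wpDl.
have := @continuous_horner_shift K p 0 0.
rewrite /prop_for /continuous_at subrr => /cvgr_dist_lt /(_ _ e0) pc.
suff : \forall w \near (0 : K)^', False by move=> /filter_ex[].
near=> w; suff : `|p.[0]| < `|p.[0]| by rewrite ltxx.
rewrite {2}[`|p.[0]|]splitr.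
have -> : p.[0] = (p.[0] - p.[w - 0]) + p.[w] by rewrite subr0 subrK.
rewrite (le_lt_trans (ler_normD _ _))// ltrD//.
  by rewrite subr0 subrK -[in X in _ - X](subr0 w); near: w; exact: nbhs_dnbhs.
have pw : `|p.[w]| <= C * `|w| by near: w.
rewrite subr0 subrK (le_lt_trans pw)//.
rewrite (@le_lt_trans _ _ ((C + 1) * `|w|))//.
  by rewrite mulrDl mul1r lerDl.
rewrite -ltr_pdivlMl// mulrC; near: w; apply: dnbhs0_lt.
by rewrite divr_gt0.
Unshelve. all: by end_near. Qed.

(** The factors ['X] come off one at a time: smallness forces a root at 0, and dividing the bound by
    [|w|] is possible on a punctured neighbourhood. *)
Lemma dvdp_small m p (C : K) : 0 <= C ->
  (\forall w \near (0 : K)^', `|p.[w]| <= C * `|w| ^+ m) -> 'X^m %| p.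
Proof.
move=> C0; elim: m p => [|m IHm] p pC; first by rewrite expr0 dvd1p.
have /factor_theorem[q pE] : root p 0.
  apply/rootP/(horner0_small C0); near=> w.
  have pw : `|p.[w]| <= C * `|w| ^+ m.+1 by near: w.
  rewrite (le_trans pw)// ler_wpM2l// exprS ler_piMr// exprn_ile1//.
  by near: w; apply: nbhs_dnbhs; exact: near0_norm_le1.
rewrite polyC0 subr0 in pE; rewrite pE exprSr dvdp_mul2r ?polyX_eq0//.
apply: IHm; near=> w.
have w0 : w != 0 by near: w; exact: nbhs_dnbhs_neq.
have : `|p.[w]| <= C * `|w| ^+ m.+1 by near: w.
by rewrite pE hornerMX normrM exprSr mulrA ler_pM2r ?normr_gt0.
Unshelve. all: by end_near. Qed.

(** The bridge from analysis to algebra: an identity of functions near 0 becomes a congruence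
    between their polynomial approximations. *)
Lemma poly_approx0_dvdp m g p : poly_approx m g p ->
  (\forall w \near (0 : K), g w = 0) -> 'X^m %| p.
Proof.
move=> [C C0 gp] g0; apply: (dvdp_small C0); apply: nbhs_dnbhs.
near=> w; rewrite -normrN -sub0r.
have <- : g w = 0 by near: w.
by near: w.
Unshelve. all: by end_near. Qed.

(** Convergence at one point [w0 > 0] bounds the terms [c n * w0 ^+ n] by some [M]. For
    [|w| <= w0 / 2] the tail is then dominated by a geometric series of ratio at most 1/2. *)
Lemma poly_approx_series m (c : nat -> K) (x : K -> K) :
  (\forall w \near (0 : K), series (fun n => c n * (w - 0) ^+ n) @ \oo --> x w) ->
  poly_approx m x (\poly_(i < m) c i).
Proof.
move=> cx; have [e /= e0 ex] := proj1 (nbhs_ballP _ _) cx.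
pose w0 : K := e / 2.
have w00 : 0 < w0 by rewrite divr_gt0.
have sw0 : series (fun n => c n * (w0 - 0) ^+ n) @ \oo --> x w0.
  apply: ex; rewrite -ball_normE /= sub0r normrN gtr0_norm//.
  by rewrite ltr_pdivrMr// ltr_pMr// ltr1n.
clearbody w0.
have [M M0 cM] : exists2 M : K, 0 < M & forall n, `|c n * w0 ^+ n| <= M.
  have /cvgP/cvg_series_cvg_0/cvgP/cvg_seq_bounded/pinfty_ex_gt0[M M0 /= cM] := sw0.
  by exists M => // n; have := cM n I; rewrite subr0.
(* The tail is at most [M r^m] times the sum 2 of the powers of 1/2, where [r = |w| / w0]. *)
exists (M * 2 / w0 ^+ m).
  by rewrite divr_ge0// ?mulr_ge0 ?exprn_ge0// ltW.
have h0 : 0 < 2^-1 * w0 by rewrite mulr_gt0// invr_gt0.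
near=> w; set r := `|w| / w0.
have r0 : 0 <= r by rewrite divr_ge0// ltW.
have r2 : r <= 2^-1.
  by rewrite ler_pdivrMr//; near: w; exact: (nbhs0_le h0).
have -> : M * 2 / w0 ^+ m * `|w| ^+ m = M * r ^+ m * 2.
  by rewrite /r expr_div_n [LHS]mulrAC [RHS]mulrAC [RHS]mulrA.
have term n : `|c n * w ^+ n| <= M * r ^+ n.
  rewrite /r expr_div_n mulrA ler_pdivlMr ?exprn_gt0//.
  rewrite !normrM normrX mulrAC ler_wpM2r ?exprn_ge0//.
  by rewrite -(gtr0_norm w00) -normrX -normrM.
pose S n := \sum_(0 <= i < n) c i * w ^+ i.
(* [2 - 2 * 2^-1 ^+ j] is the sum of the first [j] powers of 1/2. *)
have tail j : `|S (m + j)%N - S m| <= M * r ^+ m * (2 - 2 * 2^-1 ^+ j).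
  elim: j => [|j IHj]; first by rewrite addn0 subrr normr0 mulr1 subrr mulr0.
  rewrite addnS /S big_nat_recr//= addrAC (le_trans (ler_normD _ _))//.
  apply: le_trans (lerD IHj (term _)) _.
  rewrite exprD mulrA -mulrDr ler_wpM2l ?mulr_ge0 ?exprn_ge0 ?(ltW M0)//.
  have rj : r ^+ j <= 2^-1 ^+ j by rewrite lerXn2r ?nnegrE// invr_ge0.
  have -> : 2 - 2 * 2^-1 ^+ j.+1 = 2 - 2 * 2^-1 ^+ j + 2^-1 ^+ j :> K.
    by rewrite exprS mulrA mulfV// mul1r; ring.
  by rewrite lerD2l.
have TE : (\poly_(i < m) c i).[w] = S m by rewrite horner_poly /S big_mkord.
rewrite TE; apply/ler_addgt0Pr => d d0.
have Sx : S n @[n --> \oo] --> x w.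
  have : series (fun n => c n * (w - 0) ^+ n) @ \oo --> x w by near: w.
  by rewrite subr0.
have Sd : \forall n \near \oo, `|x w - S n| < d by apply: cvgr_dist_lt.
near \oo => n.
have mn : (m <= n)%N by near: n; exact: nbhs_infty_ge.
have xS : `|x w - S n| < d by near: n.
rewrite -(subrKA (S n)) addrC (le_trans (ler_normD _ _))// lerD//; last exact: ltW.
rewrite -(subnKC mn) (le_trans (tail _))// ler_wpM2l//.
  by rewrite mulr_ge0 ?exprn_ge0// ltW.
by rewrite gerBl mulr_ge0// exprn_ge0// invr_ge0.
Unshelve. all: by end_near. Qed.

End Approximation.

(** * Coefficients of an analytic inverse of a rational germ *)

Section LagrangeInversion.
Variable K : numFieldType.
Implicit Types (f x : K -> K) (b : K) (D M : {poly K}).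

(** Off [b] the factor [z - b] cancels; at [b] the limit is [D.[0] / M.[0]] by continuity. *)
Lemma extend_at_ratfun f b D M : M.[0] != 0 -> D.[0] != 0 ->
  (\forall z \near b, f z = (z - b) * (M.[z - b] / D.[z - b])) ->
  \forall z \near b, extend_at b (fun y => (y - b) / f y) z = D.[z - b] / M.[z - b].
Proof.
move=> M0 D0 fE.
have MN := @near_horner_shift_neq0 K M b M0.
have DN := @near_horner_shift_neq0 K D b D0.
have E : \forall z \near b, z != b -> (z - b) / f z = D.[z - b] / M.[z - b].
  near=> z; move=> zb.
  have -> : f z = (z - b) * (M.[z - b] / D.[z - b]) by near: z.
  have Mz : M.[z - b] != 0 by near: z.
  have Dz : D.[z - b] != 0 by near: z.
  by rewrite invfM mulrA divff ?subr_eq0// mul1r invf_div.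
have L : (y - b) / f y @[y --> b^'] --> D.[0] / M.[0].
  have C : D.[y - b] / M.[y - b] @[y --> b^'] --> D.[b - b] / M.[b - b].
    apply: cvg_within_filter.
    apply: cvgM; first exact: continuous_horner_shift.
    apply: cvgV; first by rewrite subrr.
    exact: continuous_horner_shift.
  rewrite subrr in C; apply: cvg_trans C; apply: near_eq_cvg.
  near=> z; rewrite /=.
  have zb : z != b by near: z; exact: nbhs_dnbhs_neq.
  apply/esym; move: zb; near: z; exact: nbhs_dnbhs.
near=> z; rewrite /extend_at; case: eqVneq => [->|zb].
  rewrite subrr; exact: (cvg_lim (@norm_hausdorff _ _) L).
by move: zb; near: z.
Unshelve. all: by end_near. Qed.

Lemma analytic_inverse_coef f b x D M (c : nat -> K) :
  M.[0] != 0 -> D.[0] != 0 ->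
  (\forall z \near b, f z = (z - b) * (M.[z - b] / D.[z - b])) ->
  (\forall w \near (0 : K), series (fun n => c n * (w - 0) ^+ n) @ \oo --> x w) ->
  c 0%N = b -> (\forall w \near (0 : K), f (x w) = w) ->
  forall n, (0 < n)%N -> lagrange_coef f b n b = c n * n`!%:R.
Proof.
move=> M0 D0 fE cx c0 fx n n0.
(* The approximation of order 1 gives [|x w - b| <= C |w|], hence continuity at 0, so that facts
   near [b] can be evaluated at [x w]. *)
have xb : x w @[w --> (0 : K)] --> b.
  have [C C0 xC] := poly_approx_series 1 cx.
  have C1 : 0 < C + 1 by rewrite ltr_wpDl.
  apply/(@cvgrPdist_lt _ _ _ (nbhs (0 : K)) _ x b) => e e0.
  have eC : 0 < e / (C + 1) by rewrite divr_gt0.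
  have we : \forall w \near (0 : K), `|w| < e / (C + 1) by exact: (nbhs0_lt eC).
  near=> w.
  have : `|x w - (\poly_(i < 1) c i).[w]| <= C * `|w| ^+ 1 by near: w.
  rewrite horner_poly big_ord1 mulr1 c0 expr1 distrC => /le_lt_trans; apply.
  rewrite (@le_lt_trans _ _ ((C + 1) * `|w|))//.
    by rewrite mulrDl mul1r lerDl.
  by rewrite -ltr_pdivlMl// mulrC; near: w.
pose y := \poly_(i < n.+1) c i - b%:P.
have y0 : y.[0] = 0.
  by rewrite horner_coef0 coefB coefC coef_poly /= c0 subrr.
have ay : poly_approx n.+1 (fun w => x w - b) y.
  have := poly_approxD (poly_approx_series n.+1 cx) (poly_approx_horner_id n.+1 (- b%:P)).
  by under eq_fun do rewrite hornerN hornerC.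
(* This is [f (x w) = w] with denominators cleared, transferred to the truncation [y] of [x - b]. *)
have G : 'X^(n.+1) %| y * (M \Po y) - 'X * (D \Po y).
  have := poly_approxD (poly_approxM ay (poly_approx_comp M ay))
     (poly_approxM (poly_approx_horner_id n.+1 (- 'X)) (poly_approx_comp D ay)).
  rewrite mulNr => /poly_approx0_dvdp; apply.
  have fE' := xb _ fE.
  have DN := xb _ (@near_horner_shift_neq0 K D b D0).
  near=> w; rewrite hornerN hornerX.
  have fxw : f (x w) = (x w - b) * (M.[x w - b] / D.[x w - b]) by near: w.
  have Dw : D.[x w - b] != 0 by near: w.
  have wE : f (x w) = w by near: w.
  by rewrite mulNr -[X in _ - X * _]wE fxw -mulrA mulfVK// subrr.
have [v Mv] := exists_inv_modXn n.+1 M0.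
(* [P] is a polynomial standing for [D / M] modulo ['X^(n.+1)], as [formal_lagrange] requires. *)
pose P := D * v.
have PM : 'X^(n.+1) %| P * M - D.
  have -> : P * M - D = D * (M * v - 1) by rewrite /P; ring.
  exact: dvdp_mull.
clearbody P.
have P0 : P.[0] != 0.
  have : P.[0] * M.[0] != 0.
    by rewrite -hornerM horner_coef0 (eqmodp_coef PM)// -horner_coef0.
  by rewrite mulf_eq0 negb_or => /andP[].
have Py : 'X^(n.+1) %| y - 'X * (P \Po y).
  (* As [y.[0] = 0], [M \Po y] has constant term [M.[0] != 0] and can be cancelled from the
     congruence. *)
  have cop : coprimep 'X^(n.+1) (M \Po y).
    by rewrite coprimep_expl// coprimep_sym coprimepX rootE horner_comp y0.
  rewrite -(Gauss_dvdpl _ cop).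
  have -> : (y - 'X * (P \Po y)) * (M \Po y) =
      (y * (M \Po y) - 'X * (D \Po y)) - 'X * ((P * M - D) \Po y).
    by rewrite comp_polyB comp_polyM; ring.
  apply: dvdp_sub => //; apply: dvdp_mull.
  apply: dvdp_trans (dvdp_comp_poly y PM).
  rewrite comp_Xn_poly dvdp_exp2r//.
  by rewrite -['X]subr0 -polyC0 dvdp_XsubCl rootE y0.
have yn : y`_n = c n.
  by rewrite coefB coefC coef_poly ltnSn gtn_eqF// subr0.
have := formal_lagrange n0 P0 Py; rewrite yn => cn.
have phiE := extend_at_ratfun M0 D0 fE.
(* The derivative of order [n - 1] is [(n-1)!] times the coefficient of [P ^+ n], which is
   [n * c n]; together they give [n! * c n]. *)
rewrite /lagrange_coef (@derive1n_ratfun K n.+1 n.-1 _ (D ^+ n) (M ^+ n) (P ^+ n)).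
- by rewrite -cn -mulrnA mulr_natr; case: (n) n0 => // k _; rewrite factS.
- by case: (n) n0.
- by rewrite horner_exp expf_neq0.
- by rewrite -exprMn; exact: eqmodpXn.
- near=> z; rewrite !horner_exp -expr_div_n; congr (_ ^+ _); near: z.
  exact: phiE.
Unshelve. all: by end_near. Qed.

Lemma lagrange_ratfun f b x D M : M.[0] != 0 -> D.[0] != 0 ->
  (\forall z \near b, f z = (z - b) * (M.[z - b] / D.[z - b])) ->
  local_analytic_inverse f b x ->
  \forall w \near (0 : K),
    b + \sum_(1 <= i < n) lagrange_coef f b i b * (w ^+ i / i`!%:R)
      @[n --> \oo] --> x w.
Proof.
move=> M0 D0 fE [[c cx] x0 fx].
have c0 : c 0%N = b.
  have [C C0 /nbhs_singleton] := poly_approx_series 1 cx.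
  rewrite horner_coef0 coef_poly normr0 expr1 mulr0 normr_le0 subr_eq0.
  by rewrite x0 => /eqP.
near=> w.
have cw : series (fun n => c n * (w - 0) ^+ n) @ \oo --> x w by near: w.
(* The partial sums agree only from [n = 1] on: at [n = 0] the series is empty while the other side
   is [b]. *)
apply: cvg_trans cw; apply: near_eq_cvg.
near=> n.
have n0 : (0 < n)%N by near: n; exact: nbhs_infty_gt.
rewrite /series /= subr0 big_ltn// expr0 mulr1 c0; congr (_ + _).
apply: eq_big_nat => i /andP[i1 _].
rewrite (analytic_inverse_coef M0 D0 fE cx c0 fx i1).
by rewrite mulrACA mulfV ?mulr1 ?pnatr_eq0 -?lt0n ?fact_gt0.
Unshelve. all: by end_near. Qed.

End LagrangeInversion.

(** * The rational map near a simple zero *)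

Section RationalMap.
Variables (K : numFieldType) (N : nat).
Implicit Types (mu beta a lambda : nat -> K) (b : K) (x : K -> K).

(** [D] is the product of the ['X - (beta j)%:P], so [D.[t] != 0] says that [t] avoids the poles;
    each induction step puts one more fraction over the common denominator. *)
Lemma partial_fractions_ratfun mu beta :
  (forall j, (1 <= j <= N)%N -> beta j != 0) ->
  exists D M : {poly K}, D.[0] != 0 /\ forall t, D.[t] != 0 ->
    (forall j, (1 <= j <= N)%N -> t - beta j != 0) /\
    1 + \sum_(1 <= j < N.+1) mu j / (t - beta j) = M.[t] / D.[t].
Proof.
elim: N => [|n IHn] beta0.
  exists 1, 1; rewrite hornerC oner_neq0; split=> // t _.
  split=> [[|j]//|]; by rewrite big_geq// hornerC addr0 divr1.
have [|D [M [D0 DM]]] := IHn.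
  by move=> j /andP[j1 jn]; rewrite beta0// j1 leqW.
exists (D * ('X - (beta n.+1)%:P)), (M * ('X - (beta n.+1)%:P) + mu n.+1 *: D).
split=> [|t]; first by rewrite !hornerE mulf_neq0// oppr_eq0 beta0//= ltnS leqnn.
rewrite !hornerE mulf_eq0 negb_or => /andP[Dt tb]; have [tbeta sumE] := DM t Dt.
split=> [j /andP[j1]|].
  by rewrite leq_eqVlt => /predU1P[->//|jn]; rewrite tbeta// j1.
by rewrite big_nat_recr//= addrA sumE; field; rewrite Dt tb.
Qed.

(** Subtracting [f b = 0] gives [f z = (z - b) (1 + sum of lambda j / ((b - a j) (z - a j)))]. At
    [z = b] the second factor is the derivative of [f], assumed nonzero, so [M.[0] != 0]. *)
Lemma lagrange_rational_map a lambda b x :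
  (forall j, (1 <= j <= N)%N -> a j != b) ->
  rational_map N a lambda b = 0 ->
  1 + \sum_(1 <= j < N.+1) lambda j / (b - a j) ^+ 2 != 0 ->
  let f := rational_map N a lambda in
  local_analytic_inverse f b x ->
  \forall w \near (0 : K),
    b + \sum_(1 <= i < n) lagrange_coef f b i b * (w ^+ i / i`!%:R)
      @[n --> \oo] --> x w.
Proof.
move=> ab fb df f fx.
have [|D [M [D0 DM]]] := @partial_fractions_ratfun
    (fun j => lambda j / (b - a j)) (fun j => a j - b).
  by move=> j /ab; rewrite subr_eq0.
apply: (@lagrange_ratfun K f b x D M) => //.
  apply: contra_neq df => M0; have [_ sumE] := DM 0 D0; rewrite M0 mul0r in sumE.
  rewrite -[RHS]sumE.
  congr (_ + _); apply: eq_big_nat => j _.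
  by rewrite sub0r opprB -mulrA -invfM.
have DN := @near_horner_shift_neq0 K D b D0.
near=> z; have Dz : D.[z - b] != 0 by near: z.
have [zb <-] := DM _ Dz.
(* [f z = f z - f b], and each difference of simple fractions has a factor [z - b]. *)
rewrite -[LHS]subr0 -[X in _ - X]fb /f /rational_map mulrDr mulr1.
rewrite opprD opprK addrACA [- (\sum_(_ <= _ < _) _) + _]addrC -sumrB mulr_sumr.
congr (_ + _); apply: eq_big_nat => j jN.
have := zb j jN; have := ab j jN; rewrite eq_sym -subr_eq0 => baj.
rewrite opprB addrA subrK => zaj.
by field; rewrite baj zaj.
Unshelve. all: by end_near. Qed.

End RationalMap.

(** * The real and complex expansions *)

Local Open Scope complex_scope.

Theorem proposition2p1 (R : realType) (N : nat) (a lambda : nat -> R)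
    (k : nat) (b : R)
    (hN : (1 <= N)%N)
    (ha : forall i j : nat, (1 <= i)%N -> (i < j)%N -> (j <= N)%N -> a i < a j)
    (hlambda : forall j : nat, (1 <= j <= N)%N -> 0 < lambda j)
    (hk : (k <= N)%N)
    (hb : (endpoint N a k < b%:E < endpoint N a k.+1)%E)
    (hfb : rational_map N a lambda b = 0) :
  (forall x : R -> R,
     let f := rational_map N a lambda in
     local_analytic_inverse f b x ->
     \forall w \near (0 : R),
       b + \sum_(1 <= i < n) lagrange_coef f b i b * (w ^+ i / i`!%:R)
         @[n --> \oo] --> x w) /\
  (forall x : R[i] -> R[i],
     let f := rational_map N (fun j => (a j)%:C) (fun j => (lambda j)%:C) in
     local_analytic_inverse f b%:C x ->
     \forall w \near (0 : R[i]^o),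
       ((b%:C + \sum_(1 <= i < n) lagrange_coef f b%:C i b%:C * (w ^+ i / i`!%:R)
          : R[i]^o) @[n --> \oo] --> (x w : R[i]^o))).
Proof.
(* [b] is not a pole: [a j <= a k < b] if [j <= k], and [b < a k.+1 <= a j] otherwise. *)
have ab j : (1 <= j <= N)%N -> a j != b.
  move=> /andP[j1 jN]; move: hb; rewrite /endpoint => /andP[h1 h2].
  have mono i l : (1 <= i)%N -> (i <= l)%N -> (l <= N)%N -> a i <= a l.
    move=> i1; rewrite leq_eqVlt => /predU1P[->//|il] lN; exact/ltW/ha.
  have [jk|kj] := leqP j k.
    have k0 : k != 0%N by rewrite -lt0n (leq_trans j1).
    rewrite lt_eqF//; apply: le_lt_trans (mono _ _ j1 jk hk) _.
    by move: h1; rewrite (negbTE k0) hk lte_fin.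
  rewrite gt_eqF//; apply: lt_le_trans (mono _ _ _ kj jN) => //.
  by move: h2; rewrite /= (leq_trans kj jN) lte_fin.
(* The derivative of [f] at [b] is at least 1, all [lambda j] being positive. *)
have s0 : 1 + \sum_(1 <= j < N.+1) lambda j / (b - a j) ^+ 2 != 0.
  rewrite gt_eqF// ltr_pwDl// big_nat sumr_ge0// => j jN.
  by rewrite divr_ge0 ?sqr_ge0// ltW// hlambda.
split=> x f; first exact: lagrange_rational_map.
(* The three conditions on [b] are transported along the injective field morphism from [R] to
   [R[i]]. *)
apply: (@lagrange_rational_map R[i]).
- by move=> j /ab; rewrite (inj_eq (@complexI R)).
- transitivity (rational_map N a lambda b)%:C; last by rewrite hfb.
  rewrite /rational_map rmorphB rmorph_sum; congr (_ - _).
  by apply: eq_bigr => j _; rewrite fmorph_div rmorphB.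
- rewrite -(inj_eq (@complexI R)) in s0; move: s0; congr (_ != _).
  rewrite rmorphD rmorph1 rmorph_sum; congr (_ + _).
  by apply: eq_bigr => j _; rewrite fmorph_div rmorphXn rmorphB.
Qed.
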